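(* Let $X$ and $Y$ be locally compact Hausdorff spaces. If $Y$ is pseudocompact, then the natural inclusion $\iota_{2}:C^{b}\bigl(X,C^{b}(Y)\bigr)\hookrightarrow C^{b}(X\times Y)$ is an isomorphism. If $X$ is pseudocompact and infinite, then $\iota_{2}$ is an isomorphism only if $Y$ is pseudocompact.
   Context: A space is called pseudocompact if every continuous (scalar-valued) function on it is bounded. For a $C^{*}$-algebra $A$, $C^{b}(X,A)$ denotes the $C^{*}$-algebra of all bounded continuous functions $X\to A$ (with $A$ carrying its norm topology), with pointwise operations and the supremum norm; $C^{b}(X):=C^{b}(X,\mathbb{C})$. In particular, in $C^{b}(X,C^{b}(Y))$ the algebra $C^{b}(Y)$ carries its supremum-norm topology. The natural inclusion $\iota_{2}$ is given by $\iota_{2}(f)(x,y)=f(x)(y)$ for $f\in C^{b}(X,C^{b}(Y))$, $x\in X$, $y\in Y$. *)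

(* Defs.v *)
From HB Require Import structures.
From mathcomp Require Import all_boot all_order all_algebra.
From mathcomp Require Import complex.
From mathcomp Require Import all_classical all_reals all_analysis.

Set Implicit Arguments.
Unset Strict Implicit.
Unset Printing Implicit Defensive.

Import Order.TTheory GRing.Theory Num.Theory.
Import numFieldNormedType.Exports.

Local Open Scope classical_set_scope.
Local Open Scope ring_scope.
Local Open Scope complex_scope.

Local Notation Re := complex.Re.
Local Notation Im := complex.Im.

(* Complex scalars are R[i] with R : realType.  The libraries put a topology on
   R[i]^o only; it is transported to R[i] here.  Norms of R[i]-normed modules
   take their values in R[i], where 0 <= z entails that z is real. *)
HB.instance Definition _ (R : realType) := NormedModule.copy R[i] R[i]^o.

(* C*-algebras, not assumed unital; this is why the product is a field of the
   mixin rather than that of a ring structure. *)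
HB.mixin Record isCStarAlgebra (R : realType) (A : Type)
    & CompleteNormedModule R[i] A := {
  cmul : A -> A -> A;
  cmulA : associative cmul;
  cmulDl : left_distributive cmul +%R;
  cmulDr : right_distributive cmul +%R;
  cmulZl : forall (k : R[i]) (a b : A), cmul (k *: a) b = k *: cmul a b;
  cmulZr : forall (k : R[i]) (a b : A), cmul a (k *: b) = k *: cmul a b;
  star : A -> A;
  starK : involutive star;
  starD : {morph star : a b / a + b};
  starZ : forall (k : R[i]) (a : A), star (k *: a) = conjc k *: star a;
  starM : forall a b : A, star (cmul a b) = cmul (star b) (star a);
  ler_normM : forall a b : A, `|cmul a b| <= `|a| * `|b|;
  cstar_identity : forall a : A, `|cmul (star a) a| = `|a| ^+ 2
}.

#[short(type="cstarAlgType")]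
HB.structure Definition CStarAlgebra (R : realType) :=
  {A of CompleteNormedModule R[i] A & isCStarAlgebra R A}.

Definition star_hom (R : realType) (A B : cstarAlgType R) (f : A -> B) : Prop :=
  [/\ linear f, {morph f : a b / cmul a b} & {morph f : a / star a}].

Definition cstar_iso (R : realType) (A B : cstarAlgType R) (f : A -> B) : Prop :=
  star_hom f /\ bijective f.

Lemma ge0_ReE (R : realType) (z : R[i]) : 0 <= z -> z = (Re z)%:C.
Proof. by case: z => a b /ger0_Im /= ->. Qed.

Lemma norm_ReE (R : realType) (V : normedModType R[i]) (v : V) :
  `|v| = (Re `|v|)%:C.
Proof. exact/ge0_ReE/normr_ge0. Qed.

Section ComplexNumbers.
Variable R : realType.

Lemma normc_ReIm (z : R[i]) : `|z| <= `|Re z|%:C + `|Im z|%:C.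
Proof.
rewrite [in `|z|](complexE z) (le_trans (ler_normD _ _)) // normrM.
have -> : `|'i%C| = 1 :> R[i] by rewrite normc_def /= expr0n expr1n add0r sqrtr1.
by rewrite mul1r !normc_def /= !expr0n !addr0 !sqrtr_sqr.
Qed.

Lemma normc_geIm (z : R[i]) : `|Im z|%:C <= `|z|.
Proof.
rewrite normc_def lecR -sqrtr_sqr ler_sqrt ?addr_ge0 ?sqr_ge0 //.
by rewrite lerDr sqr_ge0.
Qed.

Lemma complex_complete (F : set_system R[i]) :
  ProperFilter F -> cauchy F -> cvg F.
Proof.
move=> FF Fc.
have Re_cauchy (p : R[i] -> R^o) : (forall z, `|p z|%:C <= `|z|) ->
    (forall x y, p (x - y) = p x - p y) -> cvg (p @ F).
  move=> pn pB; apply: cauchy_cvg; apply/cauchy_exP => e e0.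
  have e0' : 0 < e%:C :> R[i] by rewrite ltcR.
  have [z Fz] := iffLR (@cauchyP R[i] R[i] F FF) Fc _ e0'.
  exists (p z); change (F (p @^-1` ball (p z) e)); apply: filterS Fz => w /=.
  rewrite -!ball_normE /= => zw; rewrite -ltcR -[_ - _]pB.
  by apply: (@le_lt_trans _ R[i] `|z - w|); [exact: pn|exact: zw].
have /cvg_ex[a Fa] : cvg ((@Re R : R[i] -> R^o) @ F).
  apply: Re_cauchy => [z|[? ?] [? ?] //]; exact: normc_ge_Re.
have /cvg_ex[b Fb] : cvg ((@Im R : R[i] -> R^o) @ F).
  apply: Re_cauchy => [z|[? ?] [? ?] //]; exact: normc_geIm.
apply/cvg_ex; exists (a +i* b).
apply/(@fcvgrPdist_lt _ R[i]) => e e0.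
have eE := ge0_ReE (ltW e0).
have FF' : Filter F by exact: filter_filter.
have r0 : 0 < Re e / 2 by rewrite divr_gt0 // -ltcR -eE.
have Pa : F [set z : R[i] | `|a - Re z| < Re e / 2] := @cvgr_dist_lt R R^o _ F FF' (@Re R) a Fa _ r0.
have Pb : F [set z : R[i] | `|b - Im z| < Re e / 2] := @cvgr_dist_lt R R^o _ F FF' (@Im R) b Fb _ r0.
change (F [set z : R[i] | `|a +i* b - z| < e]).
apply: filterS2 Pa Pb => -[x y] /= ax yb.
apply: (le_lt_trans (normc_ReIm _)).
by rewrite eE (splitr (Re e)) rmorphD /= ltrD // ltcR.
Qed.

HB.instance Definition _ := Uniform_isComplete.Build R[i] complex_complete.

Let mulZl (k a b : R[i]) : (k *: a) * b = k *: (a * b).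
Proof. by rewrite -[LHS]mulrA. Qed.

Let mulZr (k a b : R[i]) : a * (k *: b) = k *: (a * b).
Proof. exact: mulrCA. Qed.

Let conjD : {morph (@conjc R) : a b / a + b}.
Proof. exact: rmorphD. Qed.

Let conjZ (k a : R[i]) : conjc (k *: a) = conjc k *: conjc a.
Proof. exact: rmorphM. Qed.

Let conjM (a b : R[i]) : conjc (a * b) = conjc b * conjc a.
Proof. by rewrite mulrC; exact: rmorphM. Qed.

Let normM (a b : R[i]) : `|a * b| <= `|a| * `|b|.
Proof. by rewrite normrM. Qed.

Let conj_identity (a : R[i]) : `|conjc a * a| = `|a| ^+ 2.
Proof.
by case: a => x y; rewrite normrM expr2; congr (_ * _); rewrite !normc_def /= sqrrN.
Qed.

HB.instance Definition _ := @isCStarAlgebra.Build R R[i]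
  (@GRing.mul R[i]) (@mulrA R[i]) (@mulrDl R[i]) (@mulrDr R[i]) mulZl mulZr
  (@conjc R) (@conjcK R) conjD conjZ conjM normM conj_identity.

End ComplexNumbers.

Section CStarTheory.
Variables (R : realType) (A : cstarAlgType R).
Implicit Types a b : A.

Lemma norm_star a : `|star a| = `|a|.
Proof.
have le b : `|b| <= `|star b|.
  have [->|b0] := eqVneq `|b| 0; first exact: normr_ge0.
  have bp : 0 < `|b| by rewrite lt_def b0 normr_ge0.
  by rewrite -(ler_pM2r bp) -expr2 -cstar_identity ler_normM.
by apply/eqP; rewrite eq_le le andbT -{2}[a]starK.
Qed.

Lemma starB : {morph @star R A : a b / a - b}.
Proof.
move=> a b; rewrite starD; congr (_ + _).
by rewrite -scaleN1r starZ rmorphN1 scaleN1r.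
Qed.

Lemma cmulBl a b c : cmul (a - b) c = cmul a c - cmul b c.
Proof. by rewrite cmulDl -scaleN1r cmulZl scaleN1r. Qed.

Lemma cmulBr a b c : cmul a (b - c) = cmul a b - cmul a c.
Proof. by rewrite cmulDr -scaleN1r cmulZr scaleN1r. Qed.

Variable X : topologicalType.

Lemma continuous_star (f : X -> A) :
  continuous f -> continuous (fun x => star (f x)).
Proof.
move=> cf x; apply/cvgrPdist_lt => e e0; near=> y.
rewrite -starB norm_star; near: y.
exact: cvgr_dist_lt (cf x) _ e0.
Unshelve. all: by end_near. Qed.

Lemma continuous_mul (f g : X -> A) :
  continuous f -> continuous g -> continuous (fun x => cmul (f x) (g x)).
Proof.
move=> cf cg x; apply/cvgrPdist_lt => e e0 /=.
pose M := `|f x| + `|g x| + 1.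
have M0 : 0 < M by rewrite ltr_wpDl // addr_ge0 // normr_ge0.
have e2M : 0 < e / 2 / M by rewrite !divr_gt0.
near=> y.
have -> : cmul (f x) (g x) - cmul (f y) (g y) =
          cmul (f x - f y) (g y) + cmul (f x) (g x - g y).
  by rewrite cmulBl cmulBr [RHS]addrC addrA subrK.
apply: (le_lt_trans (ler_normD _ _)); rewrite (splitr e) ltrD //.
- apply: (le_lt_trans (ler_normM _ _)).
  have gyM : `|g y| <= M.
    apply: (@le_trans _ _ (`|g x| + 1)); last by rewrite /M -addrA lerDr.
    rewrite -[g y](subKr (g x)) (le_trans (ler_normB _ _)) // lerD2l ltW //.
    near: y; exact: cvgr_dist_lt (cg x) _ ltr01.
  apply: (@le_lt_trans _ _ (`|f x - f y| * M)); first exact: ler_wpM2l.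
  rewrite -ltr_pdivlMr //; near: y; exact: cvgr_dist_lt (cf x) _ e2M.
- apply: (le_lt_trans (ler_normM _ _)).
  apply: (@le_lt_trans _ _ (M * `|g x - g y|)).
    by apply: ler_wpM2r => //; rewrite /M -addrA lerDl addr_ge0.
  rewrite mulrC -ltr_pdivlMr //; near: y; exact: cvgr_dist_lt (cg x) _ e2M.
Unshelve. all: by end_near. Qed.

End CStarTheory.

Section BoundedContinuous.
Variables (R : realType) (X : topologicalType) (A : cstarAlgType R).

Definition bounded_continuous : {pred X -> A} :=
  [pred f : X -> A | `[< continuous f /\ bounded_fun f >]].

Record Cb := MkCb { cb_fun :> X -> A; _ : cb_fun \in bounded_continuous }.

HB.instance Definition _ := [isSub for cb_fun].
HB.instance Definition _ := [Choice of Cb by <:].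

Lemma bounded_continuousP (f : X -> A) :
  reflect (continuous f /\ exists M, forall x, `|f x| <= M)
          (f \in bounded_continuous).
Proof.
apply: (iffP (asboolP _)) => -[cf bf]; split=> //.
  by case: (pinfty_ex_gt0 bf) => M _ fM; exists M => x; exact: fM.
case: bf => M fM; exists `|M|; split => [|N MN x _ /=]; first exact: normr_real.
have M0 : 0 <= M by exact: le_trans (fM x).
by rewrite (le_trans (fM x)) // -(ger0_norm M0) ltW.
Qed.

Lemma cb_continuous (f : Cb) : continuous f.
Proof. by case: f => f /= /bounded_continuousP[]. Qed.

Lemma cb_bounded (f : Cb) : exists M, forall x, `|f x| <= M.
Proof. by case: f => f /= /bounded_continuousP[]. Qed.

Lemma cbP (f g : Cb) : f =1 g -> f = g.
Proof. by move=> fg; apply/val_inj/funext. Qed.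

Let submod_closed_cb : submod_closed bounded_continuous.
Proof.
split=> [|k f g /bounded_continuousP[cf [M fM]] /bounded_continuousP[cg [N gN]]].
  apply/bounded_continuousP; split; first exact: cst_continuous.
  by exists 0 => x /=; rewrite normr0.
apply/bounded_continuousP; split.
  move=> x; apply: cvgD; last exact: cg.
  by apply: cvgZr; exact: cf.
exists (`|k| * M + N) => x /=.
rewrite (le_trans (ler_normD _ _)) // lerD //.
by rewrite normrZ ler_wpM2l.
Qed.

HB.instance Definition _ :=
  GRing.isSubmodClosed.Build R[i] (X -> A) bounded_continuous submod_closed_cb.
HB.instance Definition _ := [SubChoice_isSubLmodule of Cb by <:].

Lemma cbD (f g : Cb) x : (f + g) x = f x + g x. Proof. by []. Qed.
Lemma cbB (f g : Cb) x : (f - g) x = f x - g x. Proof. by []. Qed.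
Lemma cbZ k (f : Cb) x : (k *: f) x = k *: f x. Proof. by []. Qed.

(* The supremum is taken in R; it is 0 when X is empty. *)
Definition supnorm (f : Cb) : R[i] := (sup (range (fun x => Re `|f x|)))%:C.

Lemma le_supnorm (f : Cb) x : `|f x| <= supnorm f.
Proof.
rewrite norm_ReE lecR; apply: ub_le_sup; last by exists x.
have [M fM] := cb_bounded f; exists (Re M) => _ [y _ <-].
by have := fM y; rewrite lecE => /andP[].
Qed.

Lemma supnorm_ge0 (f : Cb) : 0 <= supnorm f.
Proof.
rewrite ler0c; have [->|/set0P[_ [x _ _]]] := eqVneq (range (fun x => Re `|f x|)) set0.
  by rewrite sup0.
by rewrite -lecR (le_trans _ (le_supnorm f x)).
Qed.

Lemma supnorm_le (f : Cb) M :
  0 <= M -> (forall x, `|f x| <= M) -> supnorm f <= M.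
Proof.
move=> M0 fM; rewrite (ge0_ReE M0) lecR.
have [->|f0] := eqVneq (range (fun x => Re `|f x|)) set0.
  by rewrite sup0 -lecR -ge0_ReE.
apply: ge_sup; first exact/set0P.
by move=> _ [x _ <-]; rewrite -lecR -norm_ReE -ge0_ReE.
Qed.

Let supnormD f g : supnorm (f + g) <= supnorm f + supnorm g.
Proof.
apply: supnorm_le => [|x]; first by rewrite addr_ge0 // supnorm_ge0.
by rewrite cbD (le_trans (ler_normD _ _)) // lerD // le_supnorm.
Qed.

Let supnormZ (k : R[i]) f : supnorm (k *: f) = `|k| * supnorm f.
Proof.
have le l g : supnorm (l *: g) <= `|l| * supnorm g.
  apply: supnorm_le => [|x]; first by rewrite mulr_ge0 // supnorm_ge0.
  by rewrite cbZ normrZ ler_wpM2l // le_supnorm.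
apply/eqP; rewrite eq_le le /=.
have [->|k0] := eqVneq k 0; first by rewrite normr0 mul0r supnorm_ge0.
rewrite -ler_pdivlMl ?normr_gt0 // -normfV.
by rewrite -[in leLHS](scalerK k0 f) le.
Qed.

Let supnorm0_eq0 f : supnorm f = 0 -> f = 0.
Proof.
move=> f0; apply: cbP => x; apply/eqP.
by rewrite -normr_le0 -f0 le_supnorm.
Qed.

HB.instance Definition _ :=
  Lmodule_isNormed.Build R[i] Cb supnormD supnormZ supnorm0_eq0.

Lemma cb_normE (f : Cb) : `|f| = supnorm f. Proof. by []. Qed.

Lemma cb_complete (F : set_system Cb) : ProperFilter F -> cauchy F -> cvg F.
Proof.
move=> FF Fc.
have FF' : Filter F by exact: filter_filter.
have Fe e : 0 < e -> exists f0 : Cb, F (ball f0 e).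
  exact: (iffLR (@cauchyP R[i] Cb F FF) Fc).
have ev x : cvg ((fun f : Cb => f x) @ F).
  apply: cauchy_cvg; apply/cauchy_exP => e e0.
  have [f0 Ff0] := Fe e e0; exists (f0 x).
  change (F [set f : Cb | ball (f0 x) e (f x)]).
  apply: filterS Ff0 => f; rewrite -!ball_normE /=.
  by apply: le_lt_trans; rewrite -cbB le_supnorm.
pose g x := lim ((fun f : Cb => f x) @ F).
have Fg x : (fun f : Cb => f x) @ F --> g x by exact: ev.
have gF e (f0 : Cb) : F (ball f0 e) -> forall x, `|g x - f0 x| <= e.
  move=> Ff0 x; apply/ler_addgt0Pr => d d0.
  have Fd : F [set f : Cb | `|g x - f x| < d].
    exact: (@cvgr_dist_lt _ A _ F FF' (fun f : Cb => f x) (g x) (Fg x) d d0).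
  have [f []] := filter_ex (filterI Ff0 Fd).
  rewrite -ball_normE /= => f0f gf.
  rewrite -(subrK (f x) (g x)) -addrA addrC (le_trans (ler_normD _ _)) //.
  apply: lerD; last exact: ltW.
  by rewrite distrC; exact: le_trans (le_supnorm (f0 - f) x) (ltW f0f).
have gP : g \in bounded_continuous.
  apply/bounded_continuousP; split.
    move=> x; apply/cvgrPdist_lt => e e0.
    have e3 : 0 < e / 3%:R by rewrite divr_gt0.
    have [f0 Ff0] := Fe _ e3; near=> y.
    have -> : g x - g y = (g x - f0 x) + (f0 x - f0 y) + (f0 y - g y).
      by rewrite !subrKA.
    have -> : e = e / 3%:R + e / 3%:R + e / 3%:R.
      have e3E : e * 3%:R = e + e + e by rewrite mulr_natr !mulrS addr0 addrA.
      by rewrite -!mulrDl -e3E mulfK // pnatr_eq0.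
    rewrite (le_lt_trans (ler_normD _ _)) // ltr_leD //; last first.
      by rewrite distrC; exact: gF.
    rewrite (le_lt_trans (ler_normD _ _)) // ler_ltD //; first exact: gF.
    near: y; exact: cvgr_dist_lt (@cb_continuous f0 x) _ e3.
  have [f0 Ff0] := Fe 1 ltr01; have [M f0M] := cb_bounded f0.
  exists (1 + M) => x; rewrite -(subrK (f0 x) (g x)).
  by rewrite (le_trans (ler_normD _ _)) // lerD // gF.
apply/cvg_ex; exists (MkCb gP).
apply/(@fcvgrPdist_lt _ Cb) => e e0.
have e4 : 0 < e / 4%:R by rewrite divr_gt0.
have [f0 Ff0] := Fe _ e4.
change (F [set f : Cb | `|MkCb gP - f| < e]).
have := Ff0; apply: filterS => f; rewrite -ball_normE /= => f0f.
rewrite -(subrK f0 (MkCb gP)) -addrA (le_lt_trans (ler_normD _ _)) //.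
apply: (@le_lt_trans _ _ (e / 4%:R + e / 4%:R)).
  apply: lerD; last exact: ltW.
  by apply: supnorm_le => [|x]; [exact: ltW | exact: gF].
rewrite -mulrDl -mulr2n ltr_pdivrMr // -[e *+ 2]mulr_natr ltr_pM2l // ltr_nat //.
Unshelve. all: by end_near. Qed.

HB.instance Definition _ := Uniform_isComplete.Build Cb cb_complete.

Let cb_mul_subproof (f g : Cb) :
  (fun x => cmul (f x) (g x)) \in bounded_continuous.
Proof.
apply/bounded_continuousP; split.
  by apply: continuous_mul; exact: cb_continuous.
exists (`|f| * `|g|) => x; rewrite (le_trans (ler_normM _ _)) //.
by rewrite ler_pM // le_supnorm.
Qed.

Definition cb_mul (f g : Cb) : Cb := MkCb (cb_mul_subproof f g).

Let cb_star_subproof (f : Cb) : (fun x => star (f x)) \in bounded_continuous.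
Proof.
apply/bounded_continuousP; split.
  by apply: continuous_star; exact: cb_continuous.
by exists `|f| => x; rewrite norm_star le_supnorm.
Qed.

Definition cb_star (f : Cb) : Cb := MkCb (cb_star_subproof f).

Let cb_mulA : associative cb_mul.
Proof. by move=> f g h; apply: cbP => x; exact: cmulA. Qed.

Let cb_mulDl : left_distributive cb_mul +%R.
Proof. by move=> f g h; apply: cbP => x; exact: cmulDl. Qed.

Let cb_mulDr : right_distributive cb_mul +%R.
Proof. by move=> f g h; apply: cbP => x; exact: cmulDr. Qed.

Let cb_mulZl (k : R[i]) f g : cb_mul (k *: f) g = k *: cb_mul f g.
Proof. by apply: cbP => x; exact: cmulZl. Qed.

Let cb_mulZr (k : R[i]) f g : cb_mul f (k *: g) = k *: cb_mul f g.
Proof. by apply: cbP => x; exact: cmulZr. Qed.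

Let cb_starK : involutive cb_star.
Proof. by move=> f; apply: cbP => x; exact: starK. Qed.

Let cb_starD : {morph cb_star : f g / f + g}.
Proof. by move=> f g; apply: cbP => x; exact: starD. Qed.

Let cb_starZ (k : R[i]) f : cb_star (k *: f) = conjc k *: cb_star f.
Proof. by apply: cbP => x; exact: starZ. Qed.

Let cb_starM f g : cb_star (cb_mul f g) = cb_mul (cb_star g) (cb_star f).
Proof. by apply: cbP => x; exact: starM. Qed.

Let ler_cb_normM f g : `|cb_mul f g| <= `|f| * `|g|.
Proof.
apply: supnorm_le => [|x]; first by rewrite mulr_ge0.
by rewrite (le_trans (ler_normM _ _)) // ler_pM // le_supnorm.
Qed.

Let cb_identity f : `|cb_mul (cb_star f) f| = `|f| ^+ 2.
Proof.
have nstar : `|cb_star f| <= `|f|.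
  by apply: supnorm_le => [|x] //; rewrite norm_star le_supnorm.
apply/eqP; rewrite eq_le (le_trans (ler_cb_normM _ _)) ?expr2 ?ler_wpM2r //=.
rewrite -expr2 -[leRHS]sqrtCK ler_pXn2r ?nnegrE ?sqrtC_ge0 //.
apply: supnorm_le => [|x]; first by rewrite sqrtC_ge0.
rewrite -(@ler_pXn2r _ 2) ?nnegrE ?sqrtC_ge0 // sqrtCK -cstar_identity.
exact: (le_supnorm (cb_mul (cb_star f) f)).
Qed.

HB.instance Definition _ := @isCStarAlgebra.Build R Cb
  cb_mul cb_mulA cb_mulDl cb_mulDr cb_mulZl cb_mulZr
  cb_star cb_starK cb_starD cb_starZ cb_starM ler_cb_normM cb_identity.

Lemma cbM (f g : Cb) x : (cmul f g) x = cmul (f x) (g x).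
Proof. exact: erefl. Qed.

Lemma cb_starE (f : Cb) x : (star f) x = star (f x).
Proof. exact: erefl. Qed.

End BoundedContinuous.

Arguments Cb {R} X A.

Definition pseudocompact (R : realType) (X : topologicalType) : Prop :=
  forall f : X -> R[i], continuous f -> bounded_fun f.

Section Iota.
Variables (R : realType) (X Y : topologicalType).

Let iota2_subproof (f : Cb X (Cb Y R[i])) :
  (fun xy : X * Y => f xy.1 xy.2) \in @bounded_continuous R (X * Y)%type R[i].
Proof.
apply/bounded_continuousP; split; last first.
  exists `|f| => -[x y] /=.
  by rewrite (le_trans (le_supnorm (f x) y)) // (le_supnorm f x).
move=> [x y]; apply/cvgrPdist_lt => e e0 /=.
have e2 : 0 < e / 2 by rewrite divr_gt0.
have Px : nbhs x [set x' | `|f x - f x'| < e / 2].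
  exact: cvgr_dist_lt (@cb_continuous _ _ _ f x) _ e2.
have Py : nbhs y [set y' | `|f x y - f x y'| < e / 2].
  exact: cvgr_dist_lt (@cb_continuous _ _ _ (f x) y) _ e2.
exists ([set x' | `|f x - f x'| < e / 2], [set y' | `|f x y - f x y'| < e / 2]).
  by split.
move=> [x' y'] [/= fx fy].
have -> : f x y - f x' y' = (f x y - f x y') + (f x y' - f x' y').
  by rewrite subrKA.
rewrite (le_lt_trans (ler_normD _ _)) // (splitr e) ltrD //.
by apply: le_lt_trans fx; exact: (le_supnorm (f x - f x') y').
Qed.

Definition iota2 (f : Cb X (Cb Y R[i])) : Cb (X * Y)%type R[i] :=
  MkCb (iota2_subproof f).

Lemma iota2E f x y : iota2 f (x, y) = f x y. Proof. by []. Qed.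

Lemma iota2_star_hom : star_hom iota2.
Proof.
split=> [k f g|f g|f]; apply/val_inj/funext => -[x y].
- change (iota2 (k *: f + g) (x, y) = (k *: iota2 f + iota2 g) (x, y)).
  by rewrite iota2E !(cbD, cbZ).
- change (iota2 (cmul f g) (x, y) = (cmul (iota2 f) (iota2 g)) (x, y)).
  by rewrite iota2E !cbM.
- change (iota2 (star f) (x, y) = (star (iota2 f)) (x, y)).
  by rewrite iota2E !cb_starE.
Qed.

Lemma iota2_inj : injective iota2.
Proof.
move=> f g fg; apply: cbP => x; apply: cbP => y.
by rewrite -!iota2E fg.
Qed.

End Iota.

Arguments iota2 : clear implicits.

(* Main.v *)
(* First part: a continuous image of a pseudocompact space in a normed space is
   totally bounded.  If K is a compact neighbourhood of x0, apply this to the map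
   from Y to the bounded functions on K that sends y to F(-, y); finitely many
   slices F(-, z) are then uniformly close to all of them, so the slices are
   equicontinuous at x0, which is the sup-norm continuity of x |-> F(x, -).

   Second part: let phi : X -> R be continuous and not locally constant at x0.
   For g continuous on Y, surjectivity of iota2 makes
   F(x, y) = min(1, |g y| |phi x - phi x0|) sup-norm continuous in x at x0, where
   it vanishes; a nearby x with phi x != phi x0 and F(x, -) < 1 bounds g.  Such a
   phi exists: otherwise points are separated by clopen sets, an infinite X has a
   strictly decreasing sequence of clopen sets A n, and the function equal to
   1/(n+1) on A n \ A n.+1 and to 0 elsewhere is continuous; being locally
   constant, it has a continuous pointwise inverse (with 1/0 = 0), which is
   unbounded. *)
Require Import Defs.
From HB Require Import structures.
From mathcomp Require Import all_boot all_order all_algebra.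
From mathcomp Require Import complex.
From mathcomp Require Import all_classical all_reals all_analysis.
From mathcomp Require Import ring lra.

Set Implicit Arguments.
Unset Strict Implicit.
Unset Printing Implicit Defensive.

Import Order.TTheory GRing.Theory Num.Theory.
Import numFieldNormedType.Exports.

Local Open Scope classical_set_scope.
Local Open Scope ring_scope.
Local Open Scope complex_scope.

Local Notation Re := complex.Re.

(** * Continuous images of pseudocompact spaces in normed spaces *)

Section Pseudocompact.
Variable R : realType.

Lemma continuous_real_complex (T : topologicalType) (f : T -> R) :
  continuous f -> continuous (fun x => (f x)%:C : R[i]).
Proof.
move=> cf x; apply/cvgrPdist_lt => e e0; rewrite (ge0_ReE (ltW e0)).
have e0' : 0 < Re e by rewrite -ltcR -ge0_ReE // ltW.
near=> y; rewrite -rmorphB normc_def /= expr0n addr0 sqrtr_sqr ltcR.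
near: y; exact: cvgr_dist_lt (cf x) _ e0'.
Unshelve. all: by end_near. Qed.

Lemma continuous_Re_norm (T : topologicalType) (V : normedModType R[i])
    (f : T -> V) : continuous f -> continuous (fun x => Re `|f x| : R).
Proof.
move=> cf x; apply/cvgrPdist_lt => e e0.
have e0' : 0 < e%:C :> R[i] by rewrite ltcR.
near=> y; rewrite -ltcR.
apply: le_lt_trans (_ : `|f x - f y| < _); last first.
  by near: y; exact: cvgr_dist_lt (cf x) _ e0'.
apply: le_trans (ler_dist_dist _ _).
by rewrite [`|f x|]norm_ReE [`|f y|]norm_ReE -rmorphB normc_def /= expr0n addr0 sqrtr_sqr.
Unshelve. all: by end_near. Qed.

Lemma pseudocompact_ub (T : topologicalType) (f : T -> R) :
  pseudocompact R T -> continuous f -> exists M, forall x, f x <= M.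
Proof.
move=> psT cf; have /pinfty_ex_gt0[M _ fM] := psT _ (continuous_real_complex cf).
exists (Re M) => x; rewrite (le_trans (ler_norm _)) //.
have := fM x I; rewrite /= normc_def /= expr0n addr0 sqrtr_sqr lecE.
by case/andP.
Qed.

(** Without a finite [e]-net, a greedy choice yields a sequence with [e]-separated values; ever
    higher peaks around these values would sum to an unbounded continuous function. *)
Lemma pseudocompact_totally_bounded (T : topologicalType)
    (V : normedModType R[i]) (f : T -> V) (e : R[i]) :
  pseudocompact R T -> continuous f -> 0 < e ->
  exists s : seq T, forall y, exists2 z, z \in s & `|f y - f z| < e.
Proof.
move=> psT cf e0; apply: contrapT => /forallNP nets.
have /choice[far farP] (s : seq T) :
    exists y, forall z, z \in s -> ~ `|f y - f z| < e.
  have /existsNP[y /forall2NP yP] := nets s.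
  by exists y => z zs; have [] := yP z.
pose s := fix s n := if n is m.+1 then far (s m) :: s m else [::].
pose x n := far (s n).
have xs i n : (i < n)%N -> x i \in s n.
  elim: n => // n IHn; rewrite ltnS leq_eqVlt inE => /predU1P[->|/IHn ->].
    by rewrite eqxx.
  by rewrite orbT.
pose r := Re e; have r0 : 0 < r by rewrite -ltcR -ge0_ReE // ltW.
pose d y z : R := Re `|f y - f z|.
have dC y z : d y z = d z y by rewrite /d distrC.
have dD u y z : d y z <= d y u + d u z.
  by rewrite -lecR rmorphD /= /d -!norm_ReE ler_distD.
have x_sep i j : d (x i) (x j) < r -> i = j.
  have lt_sep k n : (k < n)%N -> r <= d (x n) (x k).
    move=> kn; rewrite leNgt -ltcR -norm_ReE /r -ge0_ReE ?ltW //.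
    by apply/negP; apply: farP; exact: xs.
  case: (ltngtP i j) => // [/lt_sep|/lt_sep]; last by rewrite ltNge => ->.
  by rewrite dC ltNge => ->.
(* The f (x n) are r-separated, so at most one peak is nonzero on the preimage of
   a ball of radius r/6, and fun y => peak (N y) y is the locally finite sum. *)
pose N y := xget 0%N [set n | d y (x n) < r / 3].
pose peak n y : R := n%:R * Num.max 0 (r / 3 - d y (x n)).
have NE n y : d y (x n) < r / 3 -> N y = n.
  move=> yn; apply: xget_unique => // m /= ym; apply: x_sep.
  rewrite (le_lt_trans (dD y _ _)) // dC; lra.
have cpeak n : continuous (peak n).
  have cd : continuous (fun y => d y (x n)).
    apply: continuous_Re_norm => y; apply: cvgB; [exact: cf|exact: cvg_cst].
  have cmax : continuous (Num.max 0 : R -> R).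
    by move=> a; apply: continuous_max; [exact: cvg_cst|exact: cvg_id].
  move=> y; apply: cvgM; first exact: cvg_cst.
  apply: (@continuous_comp _ _ _ (fun y => r / 3 - d y (x n)) (Num.max 0)).
    by apply: cvgB; [exact: cvg_cst|exact: cd].
  exact: cmax.
have cfN : continuous (fun y => peak (N y) y).
  move=> y.
  (* Two points within [r / 6] of [y] are within [r / 3] of each other, so peaks reaching them have
     centres closer than [r / 3 + r / 3 + r / 3] and coincide. *)
  have ndy : \forall z \near y, d z y < r / 6.
    near=> z; rewrite -ltcR -norm_ReE distrC; near: z.
    apply: cvgr_dist_lt (cf y) _ _; rewrite ltcR; lra.
  suff [n nE] : exists n, \forall z \near y, peak n z = peak (N z) z.
    rewrite /continuous_at -(nbhs_singleton nE).
    apply: cvg_trans (cpeak n y); exact: near_eq_cvg.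
  (* A peak reaching this ball is the only one and serves as [n]; otherwise [n] is 0. Off all peaks
     [N] takes its default 0, and [peak 0] vanishes by its factor [n]. *)
  have [[n [z [zy zn]]]|nn] := pselect (exists n z, d z y < r / 6 /\ d z (x n) < r / 3).
    exists n; apply: filterS ndy => w wy; rewrite /peak.
    have [[m wm]|nm] := pselect (exists m, d w (x m) < r / 3).
      rewrite (NE m) //; suff -> : n = m by []; apply: x_sep.
      have := dD w (x n) (x m); have := dD z (x n) w; have := dD y z w.
      have := dC y w; have := dC (x n) z; lra.
    rewrite [N w]xgetPN; last by move=> m /= wm; apply: nm; exists m.
    rewrite mul0r max_l ?mulr0 // subr_le0 leNgt.
    by apply/negP => wn; apply: nm; exists n.
  exists 0%N; apply: filterS ndy => w wy; rewrite [N w]xgetPN // => m /= wm.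
  by apply: nn; exists m, w.
have [M fM] := pseudocompact_ub psT cfN.
(* At its centre [x n] the peak has height [n * (r / 3)], which exceeds [M] for this [n]. *)
pose n := (Num.truncn (M * 3 / r)).+1.
have := fM (x n); rewrite (NE n) /peak.
  have -> : d (x n) (x n) = 0 by rewrite /d subrr normr0.
  rewrite subr0 max_r ?divr_ge0 ?(ltW r0) // leNgt => /negP; apply.
  by rewrite mulrA ltr_pdivlMr // -ltr_pdivrMr // truncnS_gt.
by rewrite /d subrr normr0 divr_gt0.
Unshelve. all: by end_near. Qed.

End Pseudocompact.

(** * Surjectivity of [iota2] for pseudocompact [Y] *)

Section PseudocompactFactor.
Variables (R : realType) (X Y : topologicalType).
Hypothesis psY : pseudocompact R Y.

Lemma slices_equicontinuous (F : X * Y -> R[i]) (K : set X) (x0 : X) (e : R[i]) :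
  continuous F -> bounded_fun F -> compact K -> nbhs x0 K -> 0 < e ->
  \forall x \near x0, forall y, `|F (x0, y) - F (x, y)| < e.
Proof.
move=> cF /pinfty_ex_gt0[M _ FM] cptK nK e0.
(* With the discrete topology on [K], [Cb] is the space of all bounded functions on [K] in the sup
   norm. *)
have slice_bc y : (fun u : discrete_topology K => F (val (u : K), y))
    \in @bounded_continuous R (discrete_topology K) R[i].
  apply/bounded_continuousP; split; last by exists M => u; exact: FM.
  move=> u A /nbhs_singleton Au; exact/principal_filterP.
pose slice y := MkCb (slice_bc y).
have cslice : continuous slice.
  move=> y0; apply/cvgrPdist_lt => d d0.
  (* One halving is for the triangle inequality through [F (x, y0)], the other keeps the supremum
     over [K] strictly below [d]. *)
  have d4 : 0 < d / 2 / 2 by rewrite !divr_gt0.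
  (* Tube argument: compactness of [K] gives one neighbourhood of [y0] that works for all [x] in
     [K]. *)
  have : \forall y \near y0, K `<=` [set x | `|F (x, y0) - F (x, y)| < d / 2].
    apply: (iffLR (compact_near_coveringP K) cptK) => x Kx.
    have [[A B] [/= nA nB] AB] := @cvgr_dist_lt _ _ _ _ _ _ _ (cF (x, y0)) _ d4.
    exists (A, B) => //= -[x' y] [/= Ax' By].
    rewrite (splitr (d / 2)) (le_lt_trans (ler_distD (F (x, y0)) _ _)) // ltrD //.
      by rewrite distrC; apply: (AB (x', y0)); split => //; exact: nbhs_singleton.
    exact: (AB (x', y)).
  apply: filterS => y Ky; apply: (@le_lt_trans _ _ (d / 2)).
    apply: supnorm_le => [|u]; first by rewrite ltW // divr_gt0.
    by rewrite cbB ltW //; apply: Ky; have := valP u; rewrite inE.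
  by rewrite ltr_pdivrMr // ltr_pMr // ltr1n.
have e3 : 0 < e / 3 by rewrite divr_gt0.
have [s sP] := pseudocompact_totally_bounded psY cslice e3.
have ns : \forall x \near x0, forall z, z \in s -> `|F (x0, z) - F (x, z)| < e / 3.
  elim: s {sP} => [|z s IHs]; first by near=> x.
  have nz : \forall x \near x0, `|F (x0, z) - F (x, z)| < e / 3.
    have [[A B] [/= nA nB] AB] := @cvgr_dist_lt _ _ _ _ _ _ _ (cF (x0, z)) _ e3.
    by apply: filterS nA => x Ax; apply: (AB (x, z)); split => //; exact: nbhs_singleton.
  by apply: filterS2 nz IHs => x zx sx w; rewrite inE => /predU1P[->|/sx].
have Kx0 := nbhs_singleton nK; apply: filterS2 ns nK => x sx Kx y; have [z zs yz] := sP y.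
(* Both [x0] and [x] lie in [K], so in either row [y] may be replaced by the net point [z]; between
   the rows only net points are compared. *)
have slice_lt w : K w -> `|F (w, y) - F (w, z)| < e / 3.
  move=> /mem_set Kw; apply: le_lt_trans yz.
  exact: (le_supnorm (slice y - slice z) (exist _ w Kw : K)).
have -> : e = e / 3 + (e / 3 + e / 3) by field.
rewrite (le_lt_trans (ler_distD (F (x0, z)) _ _)) // ltrD //.
  exact: slice_lt.
rewrite (le_lt_trans (ler_distD (F (x, z)) _ _)) // ltrD //; first exact: sx.
by rewrite distrC slice_lt.
Unshelve. all: by end_near. Qed.

Lemma iota2_surj : locally_compact [set: X] ->
  forall F : Cb (X * Y)%type R[i], exists f, iota2 R X Y f = F.
Proof.
move=> lcX F.
have [M FM] := cb_bounded F.
have row_bc x : (fun y => F (x, y)) \in @bounded_continuous R Y R[i].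
  apply/bounded_continuousP; split; last by exists M.
  move=> y; apply: (@continuous_comp _ _ _ (fun y => (x, y)) F).
    by apply: cvg_pair; [exact: cvg_cst|exact: cvg_id].
  exact: cb_continuous.
have f_bc : (fun x => MkCb (row_bc x)) \in @bounded_continuous R X (Cb Y R[i]).
  apply/bounded_continuousP; split; last first.
    by exists `|F| => x; apply: supnorm_le => // y; exact: (le_supnorm F (x, y)).
  move=> x0; apply/cvgrPdist_lt => e e0.
  have e2 : 0 < e / 2 by rewrite divr_gt0.
  have [K nK [cptK _]] := lcX x0 Logic.I.
  have nK' : nbhs x0 K by move: nK; rewrite /within /=; apply: filterS => x /(_ Logic.I).
  have /asboolP[_ bF] := valP F.
  have := slices_equicontinuous (@cb_continuous _ _ _ F) bF cptK nK' e2.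
  apply: filterS => x Fx; apply: (@le_lt_trans _ _ (e / 2)).
    by apply: supnorm_le => [|y]; [exact: ltW|rewrite cbB ltW //; exact: Fx].
  by rewrite ltr_pdivrMr // ltr_pMr // ltr1n.
by exists (MkCb f_bc); apply: cbP => -[x y].
Qed.

End PseudocompactFactor.

(** * Continuous functions on an infinite pseudocompact space *)

Section InfinitePseudocompact.
Variables (R : realType) (X : topologicalType).
Hypotheses (psX : pseudocompact R X) (infX : infinite_set [set: X]).
Hypotheses (hausX : hausdorff_space X) (lcX : locally_compact [set: X]).

Lemma not_locally_constant : exists (phi : X -> R) (x0 : X),
  continuous phi /\ forall U, nbhs x0 U -> exists2 x, U x & phi x != phi x0.
Proof.
apply: contrapT => noex.
have lcst (phi : X -> R) : continuous phi ->
    forall x0, \forall x \near x0, phi x = phi x0.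
  move=> cphi x0; apply: contrapT => nU; apply: noex.
  exists phi, x0; split => // U nxU; apply: contrapT => noU; apply: nU.
  apply: filterS nxU => x Ux; apply/eqP/negP => /negP phix.
  by apply: noU; exists x.
have clopen_sep a b : a != b -> exists C : set X, [/\ open C, open (~` C), C a & ~ C b].
  move=> ab.
  (* Complete regularity separates [a] from [b] by a continuous function; being locally constant, it
     has a clopen zero set. *)
  have : uniform_separator [set a] [set b].
    apply: (locally_compact_completely_regular (R := R)) => //.
      exact/accessible_closed_set1/hausdorff_accessible.
    by move=> /= /eqP; rewrite (negPf ab).
  move=> /(@uniform_separatorP _ R)[phi [cphi _ phia phib]].
  exists (phi @^-1` [set 0]); split => /=.
  - rewrite openE => x /= x0; rewrite /interior.
    by apply: filterS (lcst _ cphi x) => y /= ->.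
  - rewrite openE => x /= x0; rewrite /interior.
    by apply: filterS (lcst _ cphi x) => y /= ->.
  - by apply: phia; exists a.
  - have -> : phi b = 1 by apply: phib; exists b.
    by move=> /eqP; rewrite oner_eq0.
have /choice[split_off splitP] (A : set X) : exists B : set X, infinite_set A ->
    [/\ open B, open (~` B), infinite_set (A `&` B) & A `\` B !=set0].
  have [infA|] := pselect (infinite_set A); last by exists set0.
  have [a Aa] := infinite_setN0 infA.
  have [b [Ab ba]] := infinite_setN0 (infinite_setD infA (finite_set1 a)).
  have ab : a != b by apply/eqP => ab; apply: ba.
  have [C [oC oC' Ca Cb]] := clopen_sep _ _ ab.
  (* Both [C] and its complement meet [A]; [B] is one of them that meets [A] in an infinite set. *)
  have [finAC|infAC] := pselect (finite_set (A `&` C)).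
    exists (~` C) => _; split => //; first by rewrite setCK.
      move=> finAC'; apply: infA; rewrite -[A]setIT -(setUv C) setIUr.
      by rewrite finite_setU.
    by exists a; split => //; exact.
  by exists C => _; split => //; exists b.
pose A := fix A n := if n is m.+1 then A m `&` split_off (A m) else [set: X].
have infA n : infinite_set (A n) by elim: n => //= n /splitP[].
have oA n : open (A n) /\ open (~` A n).
  elim: n => [|n [oAn oAn']] /=; first by rewrite setCT; split; [exact: openT|exact: open0].
  have [oB oB' _ _] := splitP _ (infA n).
  by rewrite setCI; split; [exact: openI|exact: openU].
have subA m n : (m <= n)%N -> A n `<=` A m.
  move=> /subnK <-; elim: (n - m)%N => // k IHk; rewrite addSn /=.
  by apply: subset_trans IHk => x [].
(* These layers are open and disjoint; as [A 0] is the whole space, a point outside all of them lies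
   in every [A n]. *)
pose E n := A n `\` A n.+1.
have E_disj m n x : E m x -> E n x -> m = n.
  have wlg i j : (i < j)%N -> E i x -> E j x -> False.
    by move=> ij [_ nx] [jx _]; apply: nx; exact: subA jx.
  by move=> Em En; case: (ltngtP m n) => // /wlg; [move=> /(_ Em En)|move=> /(_ En Em)].
have oE n : open (E n) by rewrite /E setDE; apply: openI; [case: (oA n)|case: (oA n.+1)].
pose N x := xget 0%N [set n | E n x].
have NE n x : E n x -> N x = n.
  by move=> Enx; apply: xget_unique => // m Emx; exact: E_disj Enx.
pose phi x : R := if `[< exists n, E n x >] then (N x).+1%:R^-1 else 0.
have phiE n x : E n x -> phi x = n.+1%:R^-1.
  by move=> Enx; rewrite /phi (NE _ _ Enx); case: asboolP => // nE; case: nE; exists n.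
have cphi : continuous phi.
  move=> x; have [[n Enx]|nE] := pselect (exists n, E n x).
    rewrite /continuous_at (phiE _ _ Enx).
    apply: cvg_near_cst.
    have nEn : nbhs x (E n) by apply: open_nbhs_nbhs.
    by apply: filterS nEn => y; exact: phiE.
  have Ax n : A n x.
    by elim: n => // n Anx; apply: contrapT => nAx; apply: nE; exists n.
  have phix : phi x = 0 by rewrite /phi; case: asboolP.
  apply/cvgrPdist_lt => e e0; rewrite phix.
  (* On [A n] the values of [phi] are 0 or at most [1 / (n + 1)], and [n + 1] exceeds [1 / e]. *)
  pose n := Num.truncn e^-1.
  have nA : nbhs x (A n) by apply: open_nbhs_nbhs; split => //; case: (oA n).
  apply: filterS nA => y Any; rewrite sub0r normrN.
  rewrite /phi; case: asboolP => [[m Emy]|_]; last by rewrite normr0.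
  rewrite (NE _ _ Emy) ger0_norm ?invr_ge0 // invf_plt ?posrE //.
  rewrite (lt_le_trans (truncnS_gt _)) // ler_nat ltnS leqNgt.
  by apply/negP => mn; case: Emy => _; apply; exact: subA Any.
(* Local constancy survives inversion even at zeros of [phi]; on [E n] the inverse is [n + 1]. *)
have cphiV : continuous (fun x => (phi x)^-1).
  move=> x; apply: cvg_near_cst.
  by apply: filterS (lcst _ cphi x) => y ->.
have [M phiM] := pseudocompact_ub psX cphiV.
pose n := Num.truncn M.
have [_ _ _ [x Bx]] := splitP _ (infA n).
have Enx : E n x by case: Bx => Anx nBx; split => // -[].
have := phiM x; rewrite (phiE _ _ Enx) invrK leNgt => /negP; apply.
exact: truncnS_gt.
Qed.

End InfinitePseudocompact.

(** * Pseudocompactness of [Y] from surjectivity of [iota2] *)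

Lemma pseudocompact_of_iota2_surj (R : realType) (X Y : topologicalType)
    (phi : X -> R) (x0 : X) :
  continuous phi -> (forall U, nbhs x0 U -> exists2 x, U x & phi x != phi x0) ->
  (forall F : Cb (X * Y)%type R[i], exists f, iota2 R X Y f = F) ->
  pseudocompact R Y.
Proof.
move=> cphi phi_x0 surj g cg.
(* The cutoff at 1 keeps [F] bounded whatever [g] is; the factor in [phi] makes the slice at [x0]
   vanish. *)
pose F (p : X * Y) : R := Num.min 1 (Re `|g p.2| * `|phi p.1 - phi x0|).
have F01 p : 0 <= F p <= 1.
  by rewrite le_min ler01 ge_min lexx mulr_ge0 // -ler0c -norm_ReE.
have cF : continuous F.
  move=> p; apply: (@continuous_min R _ (fun=> 1) (fun p : X * Y => Re `|g p.2| * `|phi p.1 - phi x0|)).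
    exact: cvg_cst.
  apply: cvgM.
    apply: (@continuous_comp _ _ _ snd (fun y => Re `|g y|)); first exact: cvg_snd.
    exact: continuous_Re_norm.
  apply: cvg_norm; apply: cvgB; last exact: cvg_cst.
  by apply: (@continuous_comp _ _ _ fst phi); [exact: cvg_fst|exact: cphi].
have F_bc : (fun p => (F p)%:C) \in @bounded_continuous R (X * Y)%type R[i].
  apply/bounded_continuousP; split; first exact: continuous_real_complex.
  exists 1 => p; have /andP[F0 F1] := F01 p.
  by rewrite ger0_norm ?ler0c // lecR.
have [f fF] := surj (MkCb F_bc).
have fE x y : f x y = (F (x, y))%:C by rewrite -iota2E fF.
have nf : \forall x \near x0, `|f x0 - f x| < 1.
  exact: cvgr_dist_lt (@cb_continuous _ _ _ f x0) _ ltr01.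
have [x fx phix] := phi_x0 _ nf.
suff /asboolP[] : (g : Y -> R[i]) \in @bounded_continuous R Y R[i] by [].
apply/bounded_continuousP; split => //.
have c0 : 0 < `|phi x - phi x0| by rewrite normr_gt0 subr_eq0.
exists (`|phi x - phi x0|^-1)%:C => y; rewrite norm_ReE lecR -[leRHS]mul1r ler_pdivlMr //.
(* Below the cutoff the minimum is the product, which bounds [g y] uniformly in [y]. *)
have : F (x, y) < 1.
  rewrite -ltcR; apply: le_lt_trans fx.
  apply: le_trans (le_supnorm (f x0 - f x) y).
  have F0 : F (x0, y) = 0 by rewrite /F /= subrr normr0 mulr0 min_r.
  rewrite cbB !fE F0 sub0r normrN.
  by rewrite ger0_norm // ler0c; case/andP: (F01 (x, y)).
by rewrite gt_min ltxx /= => /ltW.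
Qed.

Theorem theorem3 (R : realType) (X Y : topologicalType)
    (hausX : hausdorff_space X) (lcX : locally_compact [set: X])
    (hausY : hausdorff_space Y) (lcY : locally_compact [set: Y]) :
  (pseudocompact R Y -> cstar_iso (iota2 R X Y)) /\
  (pseudocompact R X -> infinite_set [set: X] ->
     cstar_iso (iota2 R X Y) -> pseudocompact R Y).
Proof.
split=> [psY|psX infX [_ [g _ gK]]].
  split; first exact: iota2_star_hom.
  have /choice[g gK] := iota2_surj (X := X) psY lcX.
  exists g => // f; apply: (@iota2_inj R X Y); exact: gK.
have [phi [x0 [cphi phi_x0]]] := not_locally_constant psX infX hausX lcX.
apply: pseudocompact_of_iota2_surj cphi phi_x0 _ => F; exists (g F); exact: gK.
Qed.
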